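(* Let $L$ be any fragment of first-order logic such that (i) $L$ extends $\mathrm{FO}^2$, i.e. every $\mathrm{FO}^2$-formula is equivalent to a formula of $L$; (ii) $L$ is closed under substitution; and (iii) $L$ has the Craig interpolation property. Then $\mathrm{FO}\preceq_{sent} L$, i.e. every first-order sentence is equivalent to a formula of $L$.
   Context: All signatures are relational (no constant or function symbols). Following the paper's convention for $\mathrm{FO}^2$, relation symbols have arity at most $2$. An FO-fragment $L$ is a set of first-order formulas over such signatures; a formula is expressible in $L$ if it is logically equivalent to some formula of $L$. $\mathrm{FO}^2$ is the set of first-order formulas using only two variables $x,y$, where variables may be requantified and reused. $L$ is closed under substitution if for every $\varphi\in L$ containing an $n$-ary relation symbol $R$ and every $\psi(x_1,\dots,x_n)\in L$, the formula $\varphi[\psi/R]$ is expressible in $L$, where $\varphi[\psi/R]$ is obtained from $\varphi$ by replacing every subformula $R(y_1,\dots,y_n)$ by $\psi(y_1,\dots,y_n)$ (a safe substitution, i.e. with no variable capture). $L$ has the Craig interpolation property (CIP) if whenever $\varphi,\psi\in L$ and $\varphi\models\psi$, there is $\vartheta\in L$ with $\varphi\models\vartheta$, $\vartheta\models\psi$, and every non-logical symbol occurring in $\vartheta$ occurs in both $\varphi$ and $\psi$.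
   Formalization: ''Expressible in L'' / ''equivalent to a formula of L'' requires the L-formula to use no relation symbols or free variables beyond those of the given formula, and Craig interpolants may have no free variable foreign to both φ and ψ; with bare equivalence the claim is false. *)

(* Defs.v *)
From mathcomp Require Import all_boot.

Set Implicit Arguments.
Unset Strict Implicit.
Unset Printing Implicit Defensive.

(* A supply of countably many relation symbols of each arity 0, 1, 2, and no
   others; signatures are sets of symbols drawn from it. *)
Definition symbol : Type := ('I_3 * nat)%type.
Definition arity (R : symbol) : nat := R.1.

Definition var : Type := nat.

Inductive formula : Type :=
| FBot
| FEq of var & var
| FRel (R : symbol) of (arity R).-tuple var
| FNot of formula
| FAnd of formula & formula
| FOr of formula & formula
| FImp of formula & formula
| FEx of var & formula
| FAll of var & formula.

Fixpoint fv (f : formula) : seq var :=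
  match f with
  | FBot => [::]
  | FEq x y => [:: x; y]
  | FRel R t => t
  | FNot g => fv g
  | FAnd g h | FOr g h | FImp g h => fv g ++ fv h
  | FEx x g | FAll x g => [seq y <- fv g | y != x]
  end.

(* All variables, free or bound, including those bound vacuously. *)
Fixpoint vars (f : formula) : seq var :=
  match f with
  | FBot => [::]
  | FEq x y => [:: x; y]
  | FRel R t => t
  | FNot g => vars g
  | FAnd g h | FOr g h | FImp g h => vars g ++ vars h
  | FEx x g | FAll x g => x :: vars g
  end.

Fixpoint syms (f : formula) : seq symbol :=
  match f with
  | FBot | FEq _ _ => [::]
  | FRel R _ => [:: R]
  | FNot g => syms g
  | FAnd g h | FOr g h | FImp g h => syms g ++ syms h
  | FEx _ g | FAll _ g => syms g
  end.

Definition sentence (f : formula) : Prop := fv f = [::].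

(* The two distinguished variables x and y are 0 and 1. *)
Definition fo2 (f : formula) : Prop := {subset vars f <= [:: 0; 1]}.

(* A structure interprets every symbol of the supply; by coincidence this
   yields the same entailments as structures for the symbols in use only. *)
Record structure : Type := Structure {
  domain :> Type;
  domain_inhabited : inhabited domain;
  interp : forall R : symbol, (arity R).-tuple domain -> Prop
}.

Fixpoint sat (M : structure) (s : var -> M) (f : formula) : Prop :=
  match f with
  | FBot => False
  | FEq x y => s x = s y
  | FRel R t => interp (map_tuple s t)
  | FNot g => ~ sat s g
  | FAnd g h => sat s g /\ sat s h
  | FOr g h => sat s g \/ sat s h
  | FImp g h => sat s g -> sat s h
  | FEx x g => exists d : M, sat [eta s with x |-> d] g
  | FAll x g => forall d : M, sat [eta s with x |-> d] g
  end.

Definition entails (f g : formula) : Prop :=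
  forall (M : structure) (s : var -> M), sat s f -> sat s g.

Definition equivalent (f g : formula) : Prop :=
  forall (M : structure) (s : var -> M), sat s f <-> sat s g.

Definition fresh (xs : seq var) : var := (\max_(x <- xs) x).+1.

(* The name for the bound variable x of a quantified subformula with body g
   when the renaming r is pushed under the quantifier: x itself unless this
   captures the image of some other free variable of g. *)
Definition binder (r : var -> var) (x : var) (g : formula) : var :=
  let im := [seq r y | y <- fv g & y != x] in
  if x \in im then fresh im else x.

(* Capture-avoiding simultaneous renaming of the free variables. *)
Fixpoint rename (r : var -> var) (f : formula) : formula :=
  match f with
  | FBot => FBot
  | FEq x y => FEq (r x) (r y)
  | FRel R t => FRel (map_tuple r t)
  | FNot g => FNot (rename r g)
  | FAnd g h => FAnd (rename r g) (rename r h)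
  | FOr g h => FOr (rename r g) (rename r h)
  | FImp g h => FImp (rename r g) (rename r h)
  | FEx x g => let z := binder r x g in FEx z (rename [eta r with x |-> z] g)
  | FAll x g => let z := binder r x g in FAll z (rename [eta r with x |-> z] g)
  end.

(* psi(ys) for psi = psi(xs). *)
Definition inst (psi : formula) (xs ys : seq var) : formula :=
  rename (fun v => nth v ys (index v xs)) psi.

(* phi[psi/R] for psi = psi(xs).  When fv psi is contained in xs, the
   quantifiers of phi cannot capture variables of psi, so only the bound
   variables of psi need renaming, which inst takes care of. *)
Fixpoint subst (R : symbol) (xs : seq var) (psi phi : formula) : formula :=
  match phi with
  | FBot => FBot
  | FEq x y => FEq x y
  | FRel Q t => if Q == R then inst psi xs t else FRel t
  | FNot g => FNot (subst R xs psi g)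
  | FAnd g h => FAnd (subst R xs psi g) (subst R xs psi h)
  | FOr g h => FOr (subst R xs psi g) (subst R xs psi h)
  | FImp g h => FImp (subst R xs psi g) (subst R xs psi h)
  | FEx x g => FEx x (subst R xs psi g)
  | FAll x g => FAll x (subst R xs psi g)
  end.

Definition fragment : Type := formula -> Prop.

(* Equivalence to an L-formula over the same signature and in the same
   variables.  Without these two provisos the L-formulas expressing FO2 could
   be padded with vacuous symbols so that their sets of symbols form a chain;
   interpolation would then hold trivially for an L no stronger than FO2. *)
Definition expressible (L : fragment) (f : formula) : Prop :=
  exists g : formula,
    [/\ L g, equivalent g f, {subset syms g <= syms f} &
        {subset fv g <= fv f}].

Definition extends_fo2 (L : fragment) : Prop :=
  forall f : formula, fo2 f -> expressible L f.

Definition closed_under_substitution (L : fragment) : Prop :=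
  forall (phi : formula) (R : symbol) (psi : formula)
         (xs : (arity R).-tuple var),
    L phi -> R \in syms phi -> L psi -> uniq xs -> {subset fv psi <= xs} ->
    expressible L (subst R xs psi phi).

(* The interpolant has only shared symbols and introduces no free variable
   foreign to both phi and psi. *)
Definition craig_interpolation (L : fragment) : Prop :=
  forall phi psi : formula,
    L phi -> L psi -> entails phi psi ->
    exists theta : formula,
      [/\ L theta, entails phi theta, entails theta psi,
          {subset syms theta <= [predI syms phi & syms psi]} &
          {subset fv theta <= [predU fv phi & fv psi]}].

(* Main.v *)
(** Let [g] be an [L]-formula in which a unary symbol [q] occurs, and let [q']
    be a fresh copy of [q].  Then [q = {x} /\ g] entails [q' = {x} -> g(q'/q)],
    and an interpolant expresses [g] with [q(y)] replaced by [y = x].  Such a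
    replacement, which introduces a parameter, is not an instance of closure
    under substitution.  Now code a formula with free variables [v] by an
    [L]-formula over additional unary symbols [p v] that are read as the
    singletons of the values of the [v].  Atoms are coded in FO2, connectives
    by substitution, and a quantifier by turning [p v] into a parameter, which
    is then quantified.  A sentence needs no additional symbols, so its code is
    equivalent to it. *)
Require Import Defs.
From mathcomp Require Import all_boot.
From Stdlib Require Import Setoid.

Set Implicit Arguments.
Unset Strict Implicit.
Unset Printing Implicit Defensive.

(** * Structures with reinterpreted symbols *)

Definition reinterp (M : structure)
    (I : forall R : symbol, (arity R).-tuple M -> Prop) : structure :=
  Structure (domain_inhabited M) I.

(* [K] is a predicate of sequences so that no cast between tuples of lengths
   [arity Q] and [arity R] is needed. *)
Definition upd (M : structure) (R : symbol) (K : seq M -> Prop) : structure :=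
  @reinterp M (fun Q t => if Q == R then K t else interp t).

(** * Semantics of renaming and substitution *)

Lemma eq_sat (M : structure) (s1 s2 : var -> M) (f : formula) :
  {in fv f, s1 =1 s2} -> sat s1 f <-> sat s2 f.
Proof.
have bind x (d : M) (r1 r2 : var -> M) g :
  {in [seq y <- fv g | y != x], r1 =1 r2} ->
  {in fv g, [eta r1 with x |-> d] =1 [eta r2 with x |-> d]}.
  move=> eqr y gy /=; case: eqVneq => // yx.
  by apply: eqr; rewrite mem_filter yx.
have catl (r1 r2 : var -> M) g h : {in fv g ++ fv h, r1 =1 r2} ->
  {in fv g, r1 =1 r2} /\ {in fv h, r1 =1 r2}.
  by move=> eqr; split=> y yg; apply: eqr; rewrite mem_cat yg ?orbT.
elim: f s1 s2 =>
  [|x y|R t|g IH|g IHg h IHh|g IHg h IHh|g IHg h IHh|x g IH|x g IH]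
  s1 s2 /= eqs.
- by [].
- by rewrite !eqs ?inE ?eqxx ?orbT.
- suff -> : map_tuple s1 t = map_tuple s2 t by [].
  by apply/val_inj/eq_in_map.
- by rewrite (IH s1 s2).
- by have [/IHg -> /IHh ->] := catl _ _ _ _ eqs.
- by have [/IHg -> /IHh ->] := catl _ _ _ _ eqs.
- by have [/IHg -> /IHh ->] := catl _ _ _ _ eqs.
- by split=> -[d gd]; exists d; move: gd; rewrite (IH _ _ (bind _ _ _ _ _ eqs)).
- by split=> gd d; move: (gd d); rewrite (IH _ _ (bind _ _ _ _ _ eqs)).
Qed.

Lemma sat_reinterp (M : structure)
    (I J : forall R : symbol, (arity R).-tuple M -> Prop) (s : var -> M)
    (f : formula) :
  (forall R, R \in syms f -> forall t, I R t <-> J R t) ->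
  @sat (reinterp I) s f <-> @sat (reinterp J) s f.
Proof.
have catl g h :
  (forall R, R \in syms g ++ syms h -> forall t, I R t <-> J R t) ->
  (forall R, R \in syms g -> forall t, I R t <-> J R t) /\
  (forall R, R \in syms h -> forall t, I R t <-> J R t).
  by move=> eqIJ; split=> R Rg t; apply: eqIJ; rewrite mem_cat Rg ?orbT.
elim: f s => [|x y|R t|g IH|g IHg h IHh|g IHg h IHh|g IHg h IHh|x g IH|x g IH]
  s /= eqIJ.
- by [].
- by [].
- by apply: eqIJ; rewrite inE.
- by rewrite IH.
- by have [/IHg -> /IHh ->] := catl _ _ eqIJ.
- by have [/IHg -> /IHh ->] := catl _ _ eqIJ.
- by have [/IHg -> /IHh ->] := catl _ _ eqIJ.
- by split=> -[d gd]; exists d; move: gd; rewrite IH.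
- by split=> gd d; move: (gd d); rewrite IH.
Qed.

Lemma sat_upd_interp (M : structure) (R : symbol) (K : seq M -> Prop)
    (s : var -> M) (f : formula) :
  (forall t : (arity R).-tuple M, K t <-> interp t) ->
  @sat (upd R K) s f <-> sat s f.
Proof.
(* Destructing [M] makes it convertible to a [reinterp] of itself, the form that [sat_reinterp]
   requires. *)
case: M K s => D inh I K s KI.
apply: (@sat_reinterp (Structure inh I) _ I) => Q _.
by case: eqP => [-> | //].
Qed.

Lemma sat_upd_notin (M : structure) (R : symbol) (K : seq M -> Prop)
    (s : var -> M) (f : formula) :
  R \notin syms f -> @sat (upd R K) s f <-> sat s f.
Proof.
case: M K s => D inh I K s Rf.
apply: (@sat_reinterp (Structure inh I) _ I) => Q Qf t.
by rewrite ifN //; apply: contraNneq Rf => <-.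
Qed.

Lemma eq_sat_upd (M : structure) (R : symbol) (K1 K2 : seq M -> Prop)
    (s : var -> M) (f : formula) :
  (forall t : (arity R).-tuple M, K1 t <-> K2 t) ->
  @sat (upd R K1) s f <-> @sat (upd R K2) s f.
Proof.
move=> eqK; apply: sat_reinterp => Q _.
by case: eqP => [-> | //]; apply: eqK.
Qed.

Lemma fresh_notin (xs : seq var) : fresh xs \notin xs.
Proof.
apply/negP => /leq_bigmax_seq max_xs.
by have := max_xs xpredT id isT; rewrite ltnn.
Qed.

Lemma binder_notin (r : var -> var) (x : var) (g : formula) :
  binder r x g \notin [seq r y | y <- fv g & y != x].
Proof. by rewrite /binder; case: ifPn => // _; apply: fresh_notin. Qed.

Lemma sat_rename (M : structure) (r : var -> var) (s : var -> M)
    (f : formula) : sat s (rename r f) <-> sat (s \o r) f.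
Proof.
have bind x d (q : var -> var) (u : var -> M) g :
  sat ([eta u with binder q x g |-> d] \o [eta q with x |-> binder q x g]) g
  <-> sat [eta u \o q with x |-> d] g.
  apply: eq_sat => y gy /=; case: (eqVneq y x) => [_ | yx].
    by rewrite eqxx.
  case: eqVneq => // qy; have /negP[] := binder_notin q x g.
  by rewrite -qy map_f // mem_filter yx.
elim: f r s => [|x y|R t|g IH|g IHg h IHh|g IHg h IHh|g IHg h IHh|x g IH|x g IH]
  r s /=.
- by [].
- by [].
- suff -> : map_tuple s (map_tuple r t) = map_tuple (s \o r) t by [].
  by apply: val_inj; rewrite /= -map_comp.
- by rewrite IH.
- by rewrite IHg IHh.
- by rewrite IHg IHh.
- by rewrite IHg IHh.
- by split=> -[d gd]; exists d; move: gd; rewrite IH bind.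
- by split=> gd d; move: (gd d); rewrite IH bind.
Qed.

Lemma syms_rename (r : var -> var) (f : formula) : syms (rename r f) = syms f.
Proof.
by elim: f r => //= [g IHg h IHh|g IHg h IHh|g IHg h IHh] r; rewrite IHg IHh.
Qed.

Lemma fv_rename (r : var -> var) (f : formula) :
  {subset fv (rename r f) <= map r (fv f)}.
Proof.
have bind x q g : {subset fv (rename [eta q with x |-> binder q x g] g)
    <= map [eta q with x |-> binder q x g] (fv g)} ->
  {subset [seq y <- fv (rename [eta q with x |-> binder q x g] g)
             | y != binder q x g]
    <= [seq q y | y <- [seq y <- fv g | y != x]]}.
  move=> IH y; rewrite mem_filter => /andP[yz /IH /mapP[u gu /= yu]].
  move: yu yz; case: (eqVneq u x) => [_ -> | ux ->]; first by rewrite eqxx.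
  by move=> _; rewrite map_f // mem_filter ux.
elim: f r => [|x y|R t|g IH|g IHg h IHh|g IHg h IHh|g IHg h IHh|x g IH|x g IH]
  r //= y; try exact: bind.
- by rewrite map_cat !mem_cat => /orP[/IHg | /IHh] ->; rewrite ?orbT.
- by rewrite map_cat !mem_cat => /orP[/IHg | /IHh] ->; rewrite ?orbT.
- by rewrite map_cat !mem_cat => /orP[/IHg | /IHh] ->; rewrite ?orbT.
Qed.

(** The default depends on [v] because [inst] falls back on the variable itself; with equal sizes it
    is never reached. *)
Lemma map_nth_index (T : Type) (xs : seq var) (d : var -> T) (ts : seq T) :
  uniq xs -> size ts = size xs ->
  [seq nth (d v) ts (index v xs) | v <- xs] = ts.
Proof.
elim: xs ts => [|x xs IH] [|t ts] //= /andP[xxs uxs] [sz].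
rewrite eqxx /=; congr cons; rewrite -[RHS]IH //.
by apply/eq_in_map => v vxs; rewrite ifN //; apply: contraNneq xxs => ->.
Qed.

(** The relation that [psi(xs)] defines. Quantifying over assignments avoids building one from [t];
    when [xs] covers the free variables of [psi], the values outside [xs] are immaterial. *)
Definition graph (M : structure) (psi : formula) (xs : seq var) (t : seq M) :
  Prop := exists s : var -> M, map s xs = t /\ sat s psi.

Lemma sat_inst (M : structure) (s : var -> M) (psi : formula)
    (xs ys : seq var) :
  uniq xs -> size ys = size xs -> {subset fv psi <= xs} ->
  sat s (inst psi xs ys) <-> graph psi xs (map s ys).
Proof.
move=> uxs sz psixs; rewrite /inst sat_rename /=.
have eqxs : [seq s (nth v ys (index v xs)) | v <- xs] = map s ys.
  by rewrite (map_comp s) map_nth_index.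
split=> [psis | [s' [s'xs psis']]]; first by eexists; split; [exact: eqxs|].
rewrite (eq_sat (s2 := s')) // => v /psixs; apply/eq_in_map: v.
by rewrite s'xs -eqxs.
Qed.

Lemma sat_subst (M : structure) (s : var -> M) (R : symbol) (xs : seq var)
    (psi phi : formula) :
  uniq xs -> size xs = arity R -> {subset fv psi <= xs} ->
  sat s (subst R xs psi phi) <-> @sat (upd R (graph psi xs)) s phi.
Proof.
move=> uxs sz psixs.
elim: phi s => [|x y|Q t|g IH|g IHg h IHh|g IHg h IHh|g IHg h IHh|x g IH|x g IH]
  s /=.
- by [].
- by [].
- case: eqP => // QR; rewrite sat_inst //.
  by rewrite size_tuple sz QR.
- by rewrite IH.
- by rewrite IHg IHh.
- by rewrite IHg IHh.
- by rewrite IHg IHh.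
- by split=> -[d gd]; exists d; apply/IH.
- by split=> gd d; apply/IH.
Qed.

Lemma syms_subst (R : symbol) (xs : seq var) (psi phi : formula) Q :
  Q \in syms (subst R xs psi phi) ->
  (Q != R) && (Q \in syms phi) || (Q \in syms psi).
Proof.
elim: phi => //= [P t|g IHg h IHh|g IHg h IHh|g IHg h IHh].
- case: eqP => [_ | /eqP PR] /=.
    by rewrite syms_rename => ->; rewrite orbT.
  by rewrite !inE => /eqP ->; rewrite PR eqxx.
- rewrite !mem_cat => /orP[/IHg | /IHh] /orP[/andP[-> ->] | ->] //;
  by rewrite ?orbT.
- rewrite !mem_cat => /orP[/IHg | /IHh] /orP[/andP[-> ->] | ->] //;
  by rewrite ?orbT.
- rewrite !mem_cat => /orP[/IHg | /IHh] /orP[/andP[-> ->] | ->] //;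
  by rewrite ?orbT.
Qed.

Lemma fv_subst (R : symbol) (xs : seq var) (psi phi : formula) :
  size xs = arity R -> {subset fv psi <= xs} ->
  {subset fv (subst R xs psi phi) <= fv phi}.
Proof.
move=> sz psixs.
elim: phi => [|u v|Q t|g IH|g IHg h IHh|g IHg h IHh|g IHg h IHh|x g IH|x g IH]
  //= y.
- case: eqP => // QR /fv_rename /mapP[v /psixs vxs ->].
  by rewrite mem_nth // size_tuple QR -sz index_mem.
- by rewrite !mem_cat => /orP[/IHg | /IHh] ->; rewrite ?orbT.
- by rewrite !mem_cat => /orP[/IHg | /IHh] ->; rewrite ?orbT.
- by rewrite !mem_cat => /orP[/IHg | /IHh] ->; rewrite ?orbT.
- by rewrite !mem_filter => /andP[-> /IH].
- by rewrite !mem_filter => /andP[-> /IH].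
Qed.

Lemma fragment_subst (L : fragment) (hsubst : closed_under_substitution L)
    (phi psi : formula) (R : symbol) (xs : (arity R).-tuple var) :
  expressible L phi -> L psi -> uniq xs -> {subset fv psi <= xs} ->
  exists k : formula,
    [/\ L k,
        forall (M : structure) (s : var -> M),
          sat s k <-> @sat (upd R (graph psi xs)) s phi,
        forall Q, Q \in syms k ->
          (Q != R) && (Q \in syms phi) || (Q \in syms psi) &
        {subset fv k <= fv phi}].
Proof.
move=> [g [Lg g_phi gsyms gfv]] Lpsi uxs psixs.
have sz : size xs = arity R by rewrite size_tuple.
(* Closure under substitution only speaks of symbols that occur. If [R] is absent from [g], then [g]
   itself serves, since it does not see the update. *)
have [Rg | Rg] := boolP (R \in syms g); last first.
  exists g; split=> // [M s | Q Qg].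
    by rewrite -(g_phi (upd _ _)) sat_upd_notin.
  rewrite gsyms // andbT; case: eqVneq => //= QR.
  by rewrite QR (negPf Rg) in Qg.
have [k [Lk k_g ksyms kfv]] := hsubst _ _ _ xs Lg Rg Lpsi uxs psixs.
exists k; split=> // [M s | Q /ksyms /syms_subst | v /kfv /(fv_subst sz psixs)].
- by rewrite (k_g M s) sat_subst // (g_phi (upd _ _)).
- by case: (Q != R) => //= /orP[/gsyms -> | ->] //; rewrite orbT.
- exact: gfv.
Qed.

(** * Closure properties of fragments *)

Definition usym (n : nat) : symbol := (@Ordinal 3 1 isT, n).

Definition uatom (n : nat) (x : var) : formula := @FRel (usym n) [tuple x].

Lemma fresh_usym (Rs : seq symbol) : exists n, usym n \notin Rs.
Proof.
exists (fresh (map snd Rs)).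
by apply: contra (fresh_notin (map snd Rs)); apply: (map_f snd).
Qed.

Lemma graph1 (M : structure) (psi : formula) (s : var -> M) :
  {subset fv psi <= [:: 0]} -> graph psi [:: 0] [:: s 0] <-> sat s psi.
Proof.
move=> psi0; split=> [[s' [[s'0]]] | psis]; last by exists s.
by rewrite (eq_sat (s2 := s)) // => v /psi0; rewrite inE => /eqP ->.
Qed.

(** Unlike in [expressible], the bound on free variables is explicit, so that all formulas can be
    kept within the single variable 0 on which the FO2 templates act. *)
Definition definable (L : fragment) (xs : seq var) (f : formula) : Prop :=
  exists g : formula,
    [/\ L g, equivalent g f, {subset syms g <= syms f} & {subset fv g <= xs}].

Lemma fragment_definable (L : fragment) (f : formula) (xs : seq var) :
  L f -> {subset fv f <= xs} -> definable L xs f.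
Proof. by exists f; split. Qed.

Lemma fo2_definable (L : fragment) (hfo2 : extends_fo2 L) (f : formula)
    (xs : seq var) : fo2 f -> {subset fv f <= xs} -> definable L xs f.
Proof.
move=> /hfo2[g [Lg g_f gsyms gfv]] fxs.
by exists g; split=> // v /gfv /fxs.
Qed.

Variant binary_connective : (formula -> formula -> formula) -> Prop :=
| BAnd : binary_connective FAnd
| BOr : binary_connective FOr
| BImp : binary_connective FImp.

Lemma vars_binary op f g : binary_connective op ->
  vars (op f g) = vars f ++ vars g.
Proof. by case. Qed.

Lemma fv_binary op f g : binary_connective op -> fv (op f g) = fv f ++ fv g.
Proof. by case. Qed.

Lemma syms_binary op f g : binary_connective op ->
  syms (op f g) = syms f ++ syms g.
Proof. by case. Qed.

Lemma sat_binary op (M N : structure) (s : var -> M) (r : var -> N) f f' g g' :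
  binary_connective op -> (sat s f <-> sat r f') -> (sat s g <-> sat r g') ->
  sat s (op f g) <-> sat r (op f' g').
Proof. by case=> /= -> ->. Qed.

(** The FO2 template [op (uatom m 0) (uatom n 0)] receives [f] for its first atom and then [g] for
    its second. *)
Lemma definable_binary (L : fragment) (hfo2 : extends_fo2 L)
    (hsubst : closed_under_substitution L)
    (op : formula -> formula -> formula) (f g : formula) :
  binary_connective op -> definable L [:: 0] f -> definable L [:: 0] g ->
  definable L [:: 0] (op f g).
Proof.
move=> hop [f' [Lf f'_f f'syms f'fv]] [g' [Lg g'_g g'syms g'fv]].
have [m mfg] := fresh_usym (syms f' ++ syms g').
have [n] := fresh_usym (usym m :: syms f' ++ syms g').
rewrite inE negb_or => /andP[nm nfg].
have /hfo2 C2 : fo2 (op (uatom m 0) (uatom n 0)).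
  by move=> v; rewrite vars_binary // !inE orbb => ->.
have [k1 [Lk1 k1_sat k1syms k1fv]] :=
  @fragment_subst L hsubst _ f' (usym m) [tuple 0] C2 Lf isT f'fv.
have Ek1 : expressible L k1 by exists k1; split.
have [k2 [Lk2 k2_sat k2syms k2fv]] :=
  @fragment_subst L hsubst _ g' (usym n) [tuple 0] Ek1 Lg isT g'fv.
have nf : usym n \notin syms f'.
  by apply: contra nfg; rewrite mem_cat => ->.
exists k2; split=> // [M s | R /k2syms | v /k2fv /k1fv].
- rewrite k2_sat k1_sat.
  (* The substitution made last is unfolded first, so [f'] is read in a structure where [usym n]
     already means [g']. This is harmless because [usym n] does not occur in [f']. *)
  pose N := upd (usym m) (@graph (upd (usym n) (@graph M g' [:: 0])) f' [:: 0]).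
  have mE : @sat N s (uatom m 0) <-> sat s f.
    by rewrite /= eqxx graph1 // sat_upd_notin.
  have nE : @sat N s (uatom n 0) <-> sat s g.
    by rewrite /= (negPf nm) /= eqxx graph1.
  exact: sat_binary.
- rewrite syms_binary // mem_cat.
  case/orP=> [/andP[Rn /k1syms] | /g'syms ->]; last exact: orbT.
  case/orP=> [/andP[Rm] | /f'syms -> //].
  by rewrite syms_binary // !inE (negPf Rn) (negPf Rm).
- by rewrite fv_binary // !inE orbb.
Qed.

(** The sequence bounds the free variables of the result when the argument has at most the variable
    0 free. *)
Variant unary_connective : (formula -> formula) -> seq var -> Prop :=
| UNot : unary_connective FNot [:: 0]
| UEx : unary_connective (FEx 0) [::]
| UAll : unary_connective (FAll 0) [::].

Lemma definable_unary (L : fragment) (hfo2 : extends_fo2 L)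
    (hsubst : closed_under_substitution L) (op : formula -> formula)
    (xs : seq var) (f : formula) :
  unary_connective op xs -> definable L [:: 0] f -> definable L xs (op f).
Proof.
move=> hop [f' [Lf f'_f f'syms f'fv]].
have symsE h : syms (op h) = syms h by case: op xs / hop.
have /hfo2 C2 : fo2 (op (uatom 0 0)).
  by case: op xs / hop {symsE} => v /=; rewrite !inE ?orbb => ->.
(* Any symbol can be the placeholder: [f'] is read in the original structure, even if [usym 0]
   occurs in it. *)
have [k [Lk k_sat ksyms kfv]] :=
  @fragment_subst L hsubst _ f' (usym 0) [tuple 0] C2 Lf isT f'fv.
exists k; split=> // [M s | R /ksyms | v /kfv].
- rewrite k_sat.
  pose N := upd (usym 0) (@graph M f' [:: 0]).
  have opE (s' : var -> M) : @sat N s' (uatom 0 0) <-> sat s' f.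
    by rewrite /= graph1 ?f'_f.
  case: op xs / hop {C2 symsE k_sat ksyms kfv}.
  + by change (~ @sat N s (uatom 0 0) <-> ~ sat s f); rewrite opE.
  + by split=> -[d fd]; exists d; apply/opE.
  + by split=> fd d; apply/opE; apply: fd.
- by case/orP=> [/andP[R0] | /f'syms]; rewrite symsE // inE (negPf R0).
- by case: op xs / hop {C2 symsE k_sat ksyms kfv}.
Qed.

Definition singleton (n : nat) : formula :=
  FAll 1 (FAnd (FImp (uatom n 1) (FEq 1 0)) (FImp (FEq 1 0) (uatom n 1))).

Lemma sat_singleton (M : structure) (s : var -> M) (n : nat) :
  sat s (singleton n) <->
  forall t : 1.-tuple M, @interp M (usym n) t <-> t = [:: s 0] :> seq M.
Proof.
split=> [Ps t | Ps d /=].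
  have -> : t = [tuple thead t].
    by apply: val_inj; case/tupleP: t => d t; rewrite tuple0.
  have [/= P1 P2] := Ps (thead t).
  have e : map_tuple [eta s with 1 |-> thead t] [tuple 1] = [tuple thead t].
    exact: val_inj.
  rewrite e in P1 P2; split=> [/P1 -> // | [/P2]]; exact.
split=> [/Ps[] // | ds]; by apply/Ps; rewrite /= ds.
Qed.

(** * Parameters from interpolation *)

(** The interpolant contains neither [usym n] nor its copy [usym m], so each may be made the
    singleton of the parameter without affecting it. Doing so for [usym n] derives [theta] from [g];
    doing so for [usym m] gives the converse. *)
Lemma definable_param (L : fragment) (hfo2 : extends_fo2 L)
    (hsubst : closed_under_substitution L) (hcip : craig_interpolation L)
    (g : formula) (n : nat) :
  L g -> {subset fv g <= [:: 0]} ->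
  exists theta : formula,
    [/\ L theta,
        forall (M : structure) (s : var -> M),
          sat s theta <-> @sat (upd (usym n) (fun t => t = [:: s 0])) s g,
        forall R, R \in syms theta -> (R != usym n) && (R \in syms g) &
        {subset fv theta <= [:: 0]}].
Proof.
move=> Lg g0.
have Eg : expressible L g by exists g; split.
have [m] := fresh_usym (usym n :: syms g).
rewrite inE negb_or => /andP[mn mg].
have fo2_atom : fo2 (uatom m 0) by move=> v /=; rewrite !inE => ->.
(* Replacing [usym n] by its copy is the substitution of an atom, of which [c] is the equivalent in
   [L]. *)
have [c [Lc c_atom csyms cfv]] := hfo2 _ fo2_atom.
have c0 : {subset fv c <= [:: 0]} by [].
have [g' [Lg' g'_sat g'syms g'fv]] :=
  @fragment_subst L hsubst _ c (usym n) [tuple 0] Eg Lc isT c0.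
have {}g'_sat (M : structure) (s : var -> M) : sat s (singleton m) ->
    sat s g' <-> @sat (upd (usym n) (fun t => t = [:: s 0])) s g.
  move=> /sat_singleton Pm; rewrite g'_sat; apply: eq_sat_upd => t.
  rewrite -(Pm t); split=> [[s' [s't]] | Pt].
    by rewrite c_atom /= => Pt; congr interp: Pt; apply: val_inj.
  exists (fun=> thead t); rewrite c_atom /=.
  have e : map_tuple (fun=> thead t) [tuple 0] = t.
    by apply: val_inj; case/tupleP: (t) => d u; rewrite tuple0.
  by split; [rewrite -[RHS](congr1 val e) | rewrite e].
have fo2_single k : fo2 (singleton k).
  by move=> v; rewrite /= !inE; case: (v == 0); case: (v == 1).
have def_single k : definable L [:: 0] (singleton k).
  by apply: fo2_definable => // v; rewrite /= !inE orbb.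
have [phi [Lphi phiE phisyms phifv]] :=
  definable_binary hfo2 hsubst BAnd (def_single n) (fragment_definable Lg g0).
have [psi [Lpsi psiE psisyms psifv]] :=
  definable_binary hfo2 hsubst BImp (def_single m)
    (fragment_definable Lg' (fun v vg' => g0 v (g'fv v vg'))).
have [M s | theta [Ltheta phi_theta theta_psi thsyms thfv]] :=
  hcip phi psi Lphi Lpsi.
  rewrite phiE psiE => -[Pn gs] Pm; apply/g'_sat => //.
  (* By [Pn], [usym n] already is the singleton, so the update changes nothing. *)
  by rewrite sat_upd_interp // => t; rewrite (sat_singleton s n).1.
have thsyms' R : R \in syms theta -> (R != usym n) && (R \in syms g).
  move=> /thsyms; rewrite inE /= => /andP[/phisyms phiR /psisyms psiR].
  have Rm : R != usym m.
    apply: contraTneq phiR => ->.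
    by rewrite /= !inE (negPf mn) (negPf mg).
  move: psiR; rewrite /= !inE (negPf Rm) /= => /g'syms /orP[// | /csyms].
  by rewrite inE (negPf Rm).
exists theta; split=> // [M s | v /thfv /orP[/phifv | /psifv] //].
split=> [th | gs].
  pose N := upd (usym m) (fun t : seq M => t = [:: s 0]).
  have mth : usym m \notin syms theta.
    by apply: contra mg => /thsyms' /andP[].
  have Nm : @sat N s (singleton m).
    by apply/sat_singleton => t; rewrite /= eqxx.
  have Npsi : @sat N s psi by apply: theta_psi; rewrite sat_upd_notin.
  have := (g'_sat N s Nm).1 ((psiE N s).1 Npsi Nm).
  (* The update of [usym m] lies beneath that of [usym n], so the structures are compared symbol by
     symbol; [usym m] is absent from [g]. *)
  apply: (iffLR (sat_reinterp _ _)) => Q Qg t.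
  case: ifP => //= _; rewrite ifN //.
  by apply: contraNneq mg => <-.
have nth : usym n \notin syms theta.
  by apply/negP => /thsyms' /andP[]; rewrite eqxx.
rewrite -(sat_upd_notin _ s nth); apply: phi_theta; rewrite phiE.
split; last exact: gs.
by apply/sat_singleton => t; rewrite /= eqxx.
Qed.

(** * Coding variables by unary symbols *)

(* [s'] is arbitrary: the variable 0 may be free in [g], but its value is
   irrelevant.  The symbols [usym (p v)] need not be distinct or fresh for [f],
   since clashes merely restrict the structures considered. *)
Definition codes (p : var -> nat) (g f : formula) : Prop :=
  forall (M : structure) (s s' : var -> M),
    {in fv f, forall v (t : 1.-tuple M),
      @interp M (usym (p v)) t <-> t = [:: s v] :> seq M} ->
    sat s' g <-> sat s f.

(** The code is required for every [p] because the quantifier step uses the induction hypothesis at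
    a [p] changed at the bound variable. *)
Definition codable (L : fragment) (f : formula) : Prop :=
  forall p : var -> nat, exists g : formula,
    [/\ L g, codes p g f,
        {subset syms g <= syms f ++ [seq usym (p v) | v <- fv f]} &
        {subset fv g <= [:: 0]}].

Lemma codable_binary (L : fragment) (hfo2 : extends_fo2 L)
    (hsubst : closed_under_substitution L)
    (op : formula -> formula -> formula) (f g : formula) :
  binary_connective op -> codable L f -> codable L g -> codable L (op f g).
Proof.
move=> hop cf cg p.
have [f' [Lf f'_f f'syms f'fv]] := cf p.
have [g' [Lg g'_g g'syms g'fv]] := cg p.
have [k [Lk k_op ksyms kfv]] := definable_binary hfo2 hsubst hop
  (fragment_definable Lf f'fv) (fragment_definable Lg g'fv).
exists k; split=> // [M s s' Ps | R /ksyms].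
  rewrite k_op.
  have f'E : sat s' f' <-> sat s f.
    by apply: f'_f => v vf; apply: Ps; rewrite fv_binary // mem_cat vf.
  have g'E : sat s' g' <-> sat s g.
    by apply: g'_g => v vg; apply: Ps; rewrite fv_binary // mem_cat vg orbT.
  exact: sat_binary.
rewrite !syms_binary // fv_binary // map_cat !mem_cat.
case/orP=> [/f'syms | /g'syms];
  by rewrite mem_cat => /orP[] ->; rewrite ?orbT.
Qed.

Lemma codable_not (L : fragment) (hfo2 : extends_fo2 L)
    (hsubst : closed_under_substitution L) (f : formula) :
  codable L f -> codable L (FNot f).
Proof.
move=> cf p; have [f' [Lf f'_f f'syms f'fv]] := cf p.
have [k [Lk k_op ksyms kfv]] :=
  definable_unary hfo2 hsubst UNot (fragment_definable Lf f'fv).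
exists k; split=> // [M s s' Ps | R /ksyms /f'syms //].
by rewrite k_op /= (f'_f M s s' Ps).
Qed.

Variant quantifier : (var -> formula -> formula) -> Prop :=
| QEx : quantifier FEx
| QAll : quantifier FAll.

(** The bound variable is coded by a fresh symbol, which [definable_param] trades for the variable
    0; quantifying over 0 then quantifies over the values of [x]. *)
Lemma codable_quantifier (L : fragment) (hfo2 : extends_fo2 L)
    (hsubst : closed_under_substitution L) (hcip : craig_interpolation L)
    (Q : var -> formula -> formula) (x : var) (f : formula) :
  quantifier Q -> codable L f -> codable L (Q x f).
Proof.
move=> hQ cf p.
have [n] := fresh_usym (syms f ++ [seq usym (p v) | v <- fv f]).
rewrite mem_cat negb_or => /andP[nf npf].
pose q := [eta p with x |-> n].
have [f' [Lf f'_f f'syms f'fv]] := cf q.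
have [theta [Lth th_sat thsyms thfv]] :=
  definable_param hfo2 hsubst hcip n Lf f'fv.
have thE (M : structure) (s s' : var -> M) :
  {in fv (Q x f), forall v (t : 1.-tuple M),
      @interp M (usym (p v)) t <-> t = [:: s v] :> seq M} ->
  sat s' theta <-> sat [eta s with x |-> s' 0] f.
  (* With [usym n] read as the singleton of [s' 0], the structure codes [s] updated at [x].
     Freshness of [usym n] leaves [f] and the codes of its other free variables intact. *)
  move=> Ps; rewrite th_sat -(sat_upd_notin (fun t => t = [:: s' 0]) _ nf).
  apply: f'_f => v vf t /=.
  case: (eqVneq v x) => [_ | vx]; first by rewrite eqxx.
  rewrite ifN; last by apply: contraNneq npf => <-; apply: map_f.
  apply: Ps; suff: v \in [seq y <- fv f | y != x] by case: hQ.
  by rewrite mem_filter vx.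
have hop : unary_connective (Q 0) [::] by case: Q / hQ {thE}; constructor.
have [k [Lk k_op ksyms kfv]] :=
  definable_unary hfo2 hsubst hop (fragment_definable Lth thfv).
exists k; split=> // [M s s' Ps | R /ksyms Rth | v /kfv //].
  rewrite k_op; have {}thE s1 := thE M s s1 Ps.
  case: Q / hQ {k_op ksyms hop Ps} => /=.
    by split=> -[d fd]; exists d; [move/thE: fd | apply/thE].
  by split=> fd d; [move: (fd d) => /thE | apply/thE].
have {Rth} : R \in syms theta by case: Q / hQ {k_op ksyms hop thE} Rth.
move=> /thsyms /andP[Rn /f'syms]; rewrite !mem_cat.
have -> : syms (Q x f) = syms f by case: Q / hQ {k_op ksyms hop thE}.
case/orP=> [-> // | /mapP[v vf Rv]]; apply/orP; right.
have vx : v != x by apply: contraNneq Rn => vx; rewrite Rv /q /= vx eqxx.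
rewrite Rv /q /= (negPf vx); apply: map_f.
suff: v \in [seq y <- fv f | y != x] by case: Q / hQ {k_op ksyms hop thE}.
by rewrite mem_filter vx.
Qed.

(** * Codes of atomic formulas *)

(** Two singletons share an element exactly when they are equal. *)
Lemma codable_eq (L : fragment) (hfo2 : extends_fo2 L) (x y : var) :
  codable L (FEq x y).
Proof.
move=> p; pose C := FEx 0 (FAnd (uatom (p x) 0) (uatom (p y) 0)).
have [|//|k [Lk k_C ksyms kfv]] := @fo2_definable L hfo2 C [::].
  by move=> v /=; rewrite !inE; case: eqP.
exists k; split=> // [M s s' Ps | v /kfv //].
have Px := Ps x (mem_head _ _).
have Py : forall t : 1.-tuple M, _ := Ps y (mem_last x [:: y]).
rewrite k_C /=; split=> [[d [/Px /= [->] /Py /= [->]]] // | xy].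
by exists (s x); split; [apply/Px | apply/Py; rewrite /= xy].
Qed.

(** As arities are at most 2, the variables 0 and 1 can stand for the argument positions; each guard
    forces its variable to be the element coded for that argument. *)
Lemma codable_rel (L : fragment) (hfo2 : extends_fo2 L) (R : symbol)
    (t : (arity R).-tuple var) : codable L (FRel t).
Proof.
move=> p.
(* Positions beyond the arity get the trivially true guard, so the default of [nth] never enters a
   guard. The last conjunct of [C] applies [R] to the variables 0, 1, ... in order. *)
pose guard i := if i < arity R then uatom (p (nth 0 t i)) i else FNot FBot.
pose C := FEx 0 (FEx 1 (FAnd (guard 0) (FAnd (guard 1)
  (FRel (map_tuple val (ord_tuple (arity R))))))).
have leR2 : arity R < 3 by apply: ltn_ord.
have lt2 i : i < arity R -> (i == 0) || (i == 1).
  by move=> iR; have := leq_trans iR leR2; case: i {iR} => [|[|i]].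
have atom_vars v :
  v \in [seq val i | i <- ord_tuple (arity R)] -> (v == 0) || (v == 1).
  by move=> /mapP[i _ ->]; apply: lt2 (ltn_ord i).
have guard_vars i v : v \in vars (guard i) -> v = i.
  by rewrite /guard; case: ifP => //= _; rewrite inE => /eqP.
have guard_fv i v : v \in fv (guard i) -> v = i.
  by rewrite /guard; case: ifP => //= _; rewrite inE => /eqP.
have [||k [Lk k_C ksyms kfv]] := @fo2_definable L hfo2 C [::].
- move=> v /=; rewrite !inE !mem_cat.
  by case/or4P=> [-> | -> | /guard_vars -> | ] //; rewrite ?orbT //;
    case/orP=> [/guard_vars -> // | /atom_vars].
- move=> v; rewrite /= !mem_filter !mem_cat => /and3P[v0 v1].
  case/or3P=> [/guard_fv vE | /guard_fv vE | /atom_vars /orP[] vE].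
  + by rewrite vE in v0.
  + by rewrite vE in v1.
  + by rewrite vE in v0.
  + by rewrite vE in v1.
have guard_syms i Q : Q \in syms (guard i) -> Q \in [seq usym (p v) | v <- t].
  rewrite /guard; case: ifP => //= iR; rewrite inE => /eqP ->.
  by apply: (map_f (usym \o p)); apply: mem_nth; rewrite size_tuple.
exists k; split=> // [M s s' Ps | Q /ksyms | v /kfv //]; last first.
  rewrite /= !mem_cat !inE.
  by case/or3P=> [/guard_syms | /guard_syms | ] ->; rewrite ?orbT.
have guardE (u : var -> M) i :
    sat u (guard i) <-> (i < arity R -> u i = s (nth 0 t i)).
  rewrite /guard; case: ltnP => iR /=; last by split=> _ [].
  have Pi : nth 0 t i \in t by rewrite mem_nth // size_tuple.
  have := Ps _ Pi (map_tuple u [tuple i]); rewrite /= => ->.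
  by split=> [[] // | ->].
have atomE (u : var -> M) : (forall i, i < arity R -> u i = s (nth 0 t i)) ->
    map_tuple u (map_tuple val (ord_tuple (arity R))) = map_tuple s t.
  move=> ut; apply: eq_from_tnth => i; rewrite !tnth_map tnth_ord_tuple.
  by rewrite (ut _ (ltn_ord i)) (tnth_nth 0).
rewrite k_C; split=> [[a [b [/guardE g0 [/guardE g1 Rab]]]] | Rt].
  move: Rab; rewrite /= atomE // => i iR.
  by case/orP: (lt2 i iR) (iR) => /eqP ->; [apply: g0 | apply: g1].
(* Beyond the arity the default 0 gives an arbitrary witness, which nothing constrains. *)
exists (s (nth 0 t 0)), (s (nth 0 t 1)).
split; first exact/guardE.
split; first exact/guardE.
rewrite /= atomE // => i iR.
by case/orP: (lt2 i iR) => /eqP ->.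
Qed.

(** * From codes to sentences *)

Lemma codable_formula (L : fragment) (hfo2 : extends_fo2 L)
    (hsubst : closed_under_substitution L) (hcip : craig_interpolation L)
    (f : formula) : codable L f.
Proof.
elim: f => [|x y|R t|g IH|g IHg h IHh|g IHg h IHh|g IHg h IHh|x g IH|x g IH].
- move=> p.
  have [|//|k [Lk k_C ksyms kfv]] := @fo2_definable L hfo2 FBot [:: 0].
    by [].
  by exists k; split=> // M s s' _; rewrite k_C.
- exact: codable_eq.
- exact: codable_rel.
- exact: codable_not.
- by apply: codable_binary IHg IHh => //; constructor.
- by apply: codable_binary IHg IHh => //; constructor.
- by apply: codable_binary IHg IHh => //; constructor.
- by apply: codable_quantifier IH => //; constructor.
- by apply: codable_quantifier IH => //; constructor.
Qed.

Theorem theorem1 (L : fragment) (hfo2 : extends_fo2 L)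
    (hsubst : closed_under_substitution L) (hcip : craig_interpolation L) :
  forall phi : formula, sentence phi -> expressible L phi.
Proof.
move=> phi phi0.
(* The choice of [id] is arbitrary, since a sentence has no variables to code. *)
have [g [Lg g_phi gsyms gfv]] := codable_formula hfo2 hsubst hcip phi id.
(* The code may still have 0 free, though its value is irrelevant. Quantifying over 0 closes it, and
   is harmless as domains are inhabited. *)
have [k [Lk k_g ksyms kfv]] :=
  definable_unary hfo2 hsubst UEx (fragment_definable Lg gfv).
have gE (M : structure) (s s' : var -> M) : sat s' g <-> sat s phi.
  by apply: g_phi => v; rewrite phi0.
exists k; split=> // [M s | R /ksyms /gsyms | v /kfv //].
- rewrite k_g; split=> [[d /gE] | phis]; first exact.
  by case: (domain_inhabited M) => d; exists d; rewrite gE; exact: phis.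
- by rewrite phi0 cats0.
Qed.
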